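(* Let $\mathcal{G}=\{G_n\}_{n\in\mathbb{N}}$ and $\mathcal{H}=\{H_n\}_{n\in\mathbb{N}}$ be coarsely equivalent graph sequences. If $\mathcal{G}$ is hyperfinite, then $\mathcal{H}$ is hyperfinite.
   Context: A graph sequence $\mathcal{G}=\{G_n\}_{n\in\mathbb{N}}$ is a sequence of finite connected graphs whose vertex degrees are bounded by a constant $d$ independent of $n$, with $\lim_{n\to\infty}|V(G_n)|=\infty$. Here $V(G)$ and $E(G)$ denote the vertex and edge sets of $G$, and each graph carries its path metric. An $(A,A)$-quasi-isometry between metric spaces $X,X'$ is a map $f:X\to X'$ with $\frac{d(x,y)}{A}-A\le d(f(x),f(y))\le A\,d(x,y)+A$ for all $x,y\in X$ and such that every $x'\in X'$ satisfies $d(x',f(x))\le A$ for some $x\in X$. Graph sequences $\mathcal{G},\mathcal{H}$ are coarsely equivalent if there is a constant $A$ such that for every $n\in\mathbb{N}$ there exists an $(A,A)$-quasi-isometry $\phi_n:G_n\to H_n$ (between vertex sets with path metrics). A graph sequence $\mathcal{G}$ is hyperfinite if for every $\epsilon>0$ there exist a constant $K>0$ and edge sets $E_n^\epsilon\subset E(G_n)$ ($n\in\mathbb{N}$) such that (1) $\lim_{n\to\infty}\frac{|E_n^\epsilon|}{|V(G_n)|}<\epsilon$, and (2) for every $n$, each connected component of $G_n\setminus E_n^\epsilon$ (the graph obtained by deleting these edges) contains at most $K$ vertices. *)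

(* Defs.v *)
From HB Require Import structures.
From mathcomp Require Import all_boot all_order all_algebra.
From mathcomp Require Import all_classical all_reals all_analysis.

Set Implicit Arguments.
Unset Strict Implicit.
Unset Printing Implicit Defensive.

Import Order.TTheory GRing.Theory Num.Theory.
Import numFieldNormedType.Exports.

Local Open Scope ring_scope.

(* Finite connected (in particular nonempty) simple graphs. *)
Record graph := Graph {
  vertex :> finType;
  adj : rel vertex;
  adj_sym : symmetric adj;
  adj_irr : irreflexive adj;
  vertex_gt0 : (0 < #|vertex|)%N;
  adj_connected : forall x y : vertex, connect adj x y }.

Section GraphDefs.
Variable G : graph.

Definition edges : {set {set G}} :=
  [set e : {set G} | [exists x, exists y, adj x y && (e == [set x; y])]].

Definition degree (x : G) : nat := #|[set y | adj x y]|.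

Definition walk (k : nat) (x y : G) : bool :=
  [exists p : k.-tuple G, path (@adj G) x p && (last x p == y)].

Lemma walk_exists (x y : G) : exists k, walk k x y.
Proof.
have /connectP[p pP ->] := adj_connected x y.
by exists (size p); apply/existsP; exists (in_tuple p); rewrite pP eqxx.
Qed.

Definition gdist (x y : G) : nat := ex_minn (walk_exists x y).

Definition del_edges (E : {set {set G}}) : rel G :=
  [rel x y | adj x y && ([set x; y] \notin E)].

Definition components (e : rel G) : {set {set G}} :=
  equivalence_partition (connect e) [set: G].

End GraphDefs.

Local Open Scope classical_set_scope.

Definition graph_sequence (G : nat -> graph) : Prop :=
  (exists d : nat, forall n (x : G n), (degree x <= d)%N) /\
  (fun n => #|G n|) @ \oo --> \oo.

Definition quasi_isometry (R : realType) (A : R) (X X' : Type)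
    (dX : X -> X -> R) (dX' : X' -> X' -> R) (f : X -> X') : Prop :=
  (forall x y, dX x y / A - A <= dX' (f x) (f y) <= A * dX x y + A) /\
  (forall x', exists x, dX' x' (f x) <= A).

Definition coarsely_equivalent (R : realType) (G H : nat -> graph) : Prop :=
  exists2 A : R, 0 < A & forall n, exists phi : G n -> H n,
    quasi_isometry A (fun x y => (gdist x y)%:R) (fun x y => (gdist x y)%:R) phi.

(* The limit in the first clause is required to exist. *)
Definition hyperfinite (R : realType) (G : nat -> graph) : Prop :=
  forall eps : R, 0 < eps ->
  exists (K : nat) (E : forall n, {set {set G n}}),
    [/\ (0 < K)%N,
        forall n, E n \subset edges (G n),
        exists2 l : R,
          (fun n => #|E n|%:R / #|G n|%:R : R) @ \oo --> l & l < eps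
      & forall n (C : {set G n}), C \in components (del_edges (E n)) ->
          (#|C| <= K)%N].

(* Main.v *)
(** A coarse inverse [psi] of the quasi-isometry [phi : G -> H] is finite-to-one
    and sends adjacent vertices to vertices at bounded distance [r].  Cut the
    edges [xy] of [H] for which [psi x] and [psi y] lie in different components
    of [G] minus [E].  Each new component maps into an old one, so its size is
    bounded; and each cut edge has an endpoint [x] with [psi x] within [r] of an
    endpoint of [E], so there are only [O(#|E|)] cut edges.  As the edge density
    is required to converge, further edges are then cut until their number is
    exactly [floor (c * #|H n|)] for a fixed small [c]. *)
Require Import Defs.
From mathcomp Require Import all_boot all_order all_algebra.
From mathcomp Require Import all_classical all_reals all_analysis.
From mathcomp Require Import fintype finset zify ring lra.

Set Implicit Arguments.
Unset Strict Implicit.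
Unset Printing Implicit Defensive.

Import Order.TTheory GRing.Theory Num.Theory.
Import numFieldNormedType.Exports.

(** * Counting in finite sets *)

Lemma card_le_fibers (S T : finType) (f : S -> T) (A : {set S}) (B : {set T})
    (M : nat) :
  (forall x, x \in A -> f x \in B) ->
  (forall y, #|[set x | f x == y]| <= M) -> #|A| <= M * #|B|.
Proof.
move=> fAB fM; rewrite -sum1_card (partition_big f (mem B)) //=.
rewrite mulnC -sum_nat_const; apply: leq_sum => y _.
rewrite sum1_card; apply: leq_trans (fM y).
by apply/subset_leq_card/subsetP => x; rewrite !inE => /andP[].
Qed.

Lemma card_bigcup_le (S T : finType) (A : {set S}) (F : S -> {set T}) (M : nat) :
  (forall x, x \in A -> #|F x| <= M) -> #|\bigcup_(x in A) F x| <= M * #|A|.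
Proof.
move=> FM; apply: (@leq_trans (\sum_(x in A) #|F x|)).
  elim/big_rec2: _ => [|x m B _ le_Bm]; first by rewrite cards0.
  by rewrite (leq_trans (leq_card_setU _ _)) ?leq_add2l.
by rewrite mulnC -sum_nat_const; apply: leq_sum.
Qed.

(** Adding elements of [B] one at a time reaches every intermediate size. This pads a cut set to a
    prescribed cardinality. *)
Lemma exists_subset_card (T : finType) (A B : {set T}) (m : nat) :
  A \subset B -> #|A| <= m <= #|B| ->
  exists C : {set T}, [/\ A \subset C, C \subset B & #|C| = m].
Proof.
move=> sAB /andP[]; elim: m => [|m IHm] Am mB.
  by exists A; split=> //; apply/eqP; rewrite -leqn0.
case: (ltngtP #|A| m.+1) Am => // [ltAm _ | eqAm _]; last by exists A.
have [C [sAC sCB Cm]] := IHm ltAm (ltnW mB).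
have : C \proper B by rewrite properEcard sCB Cm.
case/properP=> _ [x xB xC]; exists (x |: C); split.
- exact: subset_trans sAC (subsetUr _ _).
- by rewrite subUset sub1set xB.
- by rewrite cardsU1 xC Cm.
Qed.

(** * Path metric, balls, and edge cuts in a single graph *)

Section Distance.
Variable G : graph.
Implicit Types x y z : G.

Lemma gdist_leP x y k :
  reflect (exists p, [/\ path (@adj G) x p, last x p = y & size p <= k])
          (gdist x y <= k).
Proof.
rewrite /gdist; case: ex_minnP => m walk_m m_min.
apply: (iffP idP) => [le_mk | [q [qP ql le_qk]]].
  have /existsP[p /andP[pP /eqP pl]] := walk_m.
  by exists p; rewrite size_tuple.
apply: leq_trans le_qk; apply: m_min; apply/existsP.
by exists (in_tuple q); rewrite qP ql eqxx.
Qed.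

Lemma gdistxx x : gdist x x = 0.
Proof. by apply/eqP; rewrite -leqn0; apply/gdist_leP; exists [::]. Qed.

Lemma gdist_adj x y : adj x y -> gdist x y <= 1.
Proof. by move=> xy; apply/gdist_leP; exists [:: y]; rewrite /= xy. Qed.

Lemma gdist_triangle y x z : gdist x z <= gdist x y + gdist y z.
Proof.
have /gdist_leP[p [pP pl ps]] := leqnn (gdist x y).
have /gdist_leP[q [qP ql qs]] := leqnn (gdist y z).
apply/gdist_leP; exists (p ++ q).
by rewrite cat_path pP last_cat pl qP ql size_cat leq_add.
Qed.

Lemma gdist_sym x y : gdist x y = gdist y x.
Proof.
suff le_sym (u v : G) : gdist u v <= gdist v u.
  by apply/eqP; rewrite eqn_leq !le_sym.
have /gdist_leP[p [pP <- ps]] := leqnn (gdist v u).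
apply/gdist_leP; exists (rev (belast v p)).
rewrite size_rev size_belast; split=> //.
  by rewrite rev_path (eq_path (fun a b => adj_sym b a)).
by case: p {pP ps} => //= w p; rewrite rev_cons last_rcons.
Qed.

(** A ball of radius [k.+1] is covered by its centre and the radius-[k] balls around at most [d]
    neighbours, and [1 + d * d.+1 ^ k <= d.+1 ^ k.+1]. *)
Lemma card_ball (d k : nat) x :
  (forall y, degree y <= d) -> #|[set y | gdist x y <= k]| <= d.+1 ^ k.
Proof.
move=> deg_d; elim: k x => [|k IHk] x.
  rewrite expn0 -(cards1 x); apply/subset_leq_card/subsetP => y.
  by rewrite !inE => /gdist_leP[[|z p] [_ /= <- //]].
apply: (@leq_trans #|x |: \bigcup_(z in [set z | adj x z])
                          [set y | gdist z y <= k]|).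
  apply/subset_leq_card/subsetP => y; rewrite !inE.
  case/gdist_leP=> [[|z p]] [/= pP pl ps]; first by rewrite pl eqxx.
  case/andP: pP => xz pP; apply/orP; right.
  apply/bigcupP; exists z; rewrite inE //; apply/gdist_leP.
  by exists p.
rewrite (leq_trans (leq_card_setU _ _)) // cards1.
have := card_bigcup_le (A := [set z | adj x z]) (fun z _ => IHk z).
have := deg_d x; rewrite /degree; set D := #|_|; set N := #|_| => le_D le_N.
have : 0 < d.+1 ^ k by rewrite expn_gt0.
rewrite expnS; nia.
Qed.

(** A path between separated vertices must use a deleted edge; [z] is the starting point of the
    first one. *)
Lemma path_meets_cover (E : {set {set G}}) x p :
  path (@adj G) x p -> ~~ connect (del_edges E) x (last x p) ->
  exists2 z, z \in cover E & gdist x z <= size p.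
Proof.
elim: p x => [|y p IHp] x /=; first by rewrite connect0.
case/andP=> xy pP ncon; case: (boolP ([set x; y] \in E)) => [xyE | xyE].
  by exists x; rewrite ?gdistxx //; apply/bigcupP; exists [set x; y]; rewrite ?set21.
have con_xy : connect (del_edges E) x y by apply/connect1/andP.
have [|z zE le_yz] := IHp y pP.
  by apply: contra ncon; apply: connect_trans.
exists z => //; apply: leq_trans (gdist_triangle y x z) _.
by rewrite -add1n leq_add ?gdist_adj.
Qed.

Lemma card_cover_edges (E : {set {set G}}) :
  E \subset edges G -> #|cover E| <= 2 * #|E|.
Proof.
move=> sE; apply: card_bigcup_le => e /(subsetP sE).
rewrite inE => /existsP[x /existsP[y /andP[_ /eqP->]]].
by rewrite cards2; case: (_ != _).
Qed.

(** By connectedness every vertex lies on an edge. This guarantees enough edges for the later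
    padding. *)
Lemma card_vertex_le_edges : 1 < #|G| -> #|G| <= 2 * #|edges G|.
Proof.
move=> G_gt1; apply: leq_trans (card_cover_edges (subxx _)).
apply/subset_leq_card/subsetP => x _.
have [y] : exists y, y \in [set~ x].
  by apply/set0Pn; rewrite -card_gt0 cardsC1; case: #|G| G_gt1 => [|[]].
rewrite !inE => neq_yx.
have /connectP[[|z p] /= pP yl] := adj_connected x y.
  by rewrite yl eqxx in neq_yx.
case/andP: pP => xz _; apply/bigcupP; exists [set x; z]; rewrite ?set21 //.
by rewrite inE; apply/existsP; exists x; apply/existsP; exists z; rewrite xz eqxx.
Qed.

Lemma connect_class_component (E : {set {set G}}) x :
  [set y | connect (del_edges E) x y] \in components (del_edges E).
Proof.
by apply/imsetP; exists x; rewrite ?inE //; apply/setP => y; rewrite !inE.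
Qed.

End Distance.

(** * Transporting an edge cut along a coarse map *)

(** The factors count, in order: edges at a vertex of [H], points in a fiber of [psi], points in an
    [r]-ball, endpoints of an edge of [E]. Quantifying over all [F'] containing [F] leaves room for
    padding. *)
Lemma coarse_edge_cut (G H : graph) (d a r K : nat) (psi : H -> G)
    (E : {set {set G}}) :
  (forall x : G, degree x <= d) -> (forall x : H, degree x <= d) ->
  (forall x y : H, adj x y -> gdist (psi x) (psi y) <= r) ->
  (forall y : G, #|[set x | psi x == y]| <= a) ->
  E \subset edges G ->
  (forall C : {set G}, C \in components (del_edges E) -> #|C| <= K) ->
  exists F : {set {set H}},
    [/\ F \subset edges H, #|F| <= d * (a * (d.+1 ^ r * 2)) * #|E|
      & forall F' : {set {set H}}, F \subset F' ->
        forall C : {set H}, C \in components (del_edges F') -> #|C| <= a * K].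
Proof.
move=> degG degH psi_r psi_a sE EK.
pose cut x y := adj x y && ~~ connect (del_edges E) (psi x) (psi y).
pose F := [set e : {set H} | [exists x, exists y, cut x y && (e == [set x; y])]].
exists F; split.
- apply/subsetP => e; rewrite !inE => /existsP[x /existsP[y]].
  case/andP=> /andP[xy _] /eqP->; apply/existsP; exists x.
  by apply/existsP; exists y; rewrite xy eqxx.
- pose T := \bigcup_(z in cover E) [set u | gdist z u <= r].
  pose S := [set x | psi x \in T].
  have le_T : #|T| <= d.+1 ^ r * #|cover E|.
    by apply: card_bigcup_le => z _; apply: card_ball.
  have le_S : #|S| <= a * #|T|.
    by apply: (card_le_fibers (f := psi)) => // x; rewrite inE.
  apply: (@leq_trans #|\bigcup_(x in S)
            [set [set x; y] | y in [set y | adj x y]]|).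
    apply/subset_leq_card/subsetP => e; rewrite inE.
    case/existsP=> x /existsP[y /andP[/andP[xy ncon] /eqP->]].
    apply/bigcupP; exists x; last by apply: imset_f; rewrite inE.
    have /gdist_leP[p [pP pl ps]] := psi_r _ _ xy.
    rewrite -pl in ncon; have [z zE le_z] := path_meets_cover pP ncon.
    rewrite inE; apply/bigcupP; exists z => //.
    by rewrite inE gdist_sym (leq_trans le_z).
  apply: leq_trans (card_bigcup_le (M := d) _) _.
    by move=> x _; apply: leq_trans (leq_imset_card _ _) (degH x).
  rewrite -mulnA leq_mul2l; apply/orP; right.
  apply: leq_trans le_S _; rewrite -mulnA leq_mul2l; apply/orP; right.
  apply: leq_trans le_T _; rewrite -mulnA leq_mul2l; apply/orP; right.
  exact: card_cover_edges.
- move=> F' sF C /imsetP[x _ ->].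
  have := EK _ (connect_class_component E (psi x)).
  set B := [set u | _] => le_B; apply: (@leq_trans (a * #|B|)); last first.
    by rewrite leq_mul2l le_B orbT.
  apply: (card_le_fibers (f := psi)) => // y; rewrite !inE /=.
  case/connectP=> p + ->; elim: p x {B le_B} => [|z p IHp] x /=.
    by rewrite connect0.
  case/andP=> /andP[xz xzF] /IHp; apply: connect_trans.
  (* An edge outside [F'] is outside [F], so [psi] sends its ends to one component. *)
  apply: contraNT xzF => ncon; apply: (subsetP sF).
  rewrite inE; apply/existsP; exists x; apply/existsP; exists z.
  by rewrite /cut xz ncon eqxx.
Qed.

(** * Constants from a quasi-isometry *)

Local Open Scope ring_scope.

Lemma quasi_isometry_nat (R : realType) (A : R) (G H : graph) (phi : G -> H)
    (a : nat) :
  0 < A -> A <= a%:R ->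
  quasi_isometry A (fun x y => (gdist x y)%:R) (fun x y => (gdist x y)%:R) phi ->
  (forall x y, gdist x y <= a * gdist (phi x) (phi y) + a * a)%N /\
  (forall h, exists x, gdist h (phi x) <= a)%N.
Proof.
move=> A_gt0 le_Aa [qi_dist qi_surj]; split=> [x y | h]; last first.
  by have [x le_x] := qi_surj h; exists x; rewrite -(ler_nat R) (le_trans le_x).
have /andP[+ _] := qi_dist x y; rewrite lerBlDr ler_pdivrMr // => le_xy.
rewrite -(ler_nat R) natrD !natrM; apply: le_trans le_xy _.
rewrite mulrDl [_ * A]mulrC lerD //; first by rewrite ler_wpM2r.
by apply: ler_pM => //; apply: ltW.
Qed.

(** [M] is chosen before the graphs, from [A] and [d] alone, so that one constant serves all indices
    of the sequences. *)
Lemma quasi_isometry_edge_cut (R : realType) (A : R) (d : nat) :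
  0 < A -> exists M : nat, forall (G H : graph) (phi : G -> H),
  (forall x : G, (degree x <= d)%N) -> (forall x : H, (degree x <= d)%N) ->
  quasi_isometry A (fun x y => (gdist x y)%:R) (fun x y => (gdist x y)%:R) phi ->
  (#|G| <= M * #|H|)%N /\
  forall (E : {set {set G}}) (K : nat), E \subset edges G ->
  (forall C : {set G}, C \in components (del_edges E) -> (#|C| <= K)%N) ->
  exists F : {set {set H}},
    [/\ F \subset edges H, (#|F| <= M * #|E|)%N
      & forall F' : {set {set H}}, F \subset F' ->
        forall C : {set H}, C \in components (del_edges F') ->
        (#|C| <= M * K)%N].
Proof.
move=> A_gt0; pose a := (Num.truncn A).+1.
have le_Aa : A <= a%:R by apply/ltW/truncnS_gt.
(* For adjacent [x], [y] the points [phi (psi x)] and [phi (psi y)] are within [2 * a + 1], whence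
   [r]. A fiber of [psi] over [y] lies in the [a]-ball around [phi y], whence [b]. *)
pose r := (a * (2 * a + 1) + a * a)%N.
pose b := (d.+1 ^ a)%N; pose c := (d * (b * (d.+1 ^ r * 2)))%N.
exists (d.+1 ^ (a * a) + b + c)%N => G H phi degG degH.
case/(quasi_isometry_nat A_gt0 le_Aa) => phi_dist phi_surj; split.
  have : (#|[set: G]| <= d.+1 ^ (a * a) * #|[set: H]|)%N.
    apply: (card_le_fibers (f := phi)) => [x|y]; first by rewrite !inE.
    (* Points with the same image under [phi] are within [a * a] of each other, so a nonempty fiber
       fits in one ball. *)
    case: (set_0Vmem [set x | phi x == y]) => [->|[x0]]; first by rewrite cards0.
    rewrite inE => /eqP phi_x0; apply: leq_trans (card_ball (a * a) x0 degG).
    apply/subset_leq_card/subsetP => x; rewrite !inE => /eqP phi_x.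
    by have := phi_dist x0 x; rewrite phi_x0 phi_x gdistxx muln0.
  rewrite !cardsT => /leq_trans-> //.
  by rewrite leq_mul2r -addnA leq_addr orbT.
have [psi psi_a] := choice phi_surj.
move=> E K sE EK.
have psi_r x y : adj x y -> (gdist (psi x) (psi y) <= r)%N.
  move=> xy; apply: leq_trans (phi_dist _ _) _; rewrite leq_add2r leq_mul2l.
  apply/orP; right; apply: leq_trans (gdist_triangle x _ _) _.
  apply: leq_trans (leq_add (leqnn _) (gdist_triangle y _ _)) _.
  have := psi_a x; have := psi_a y; have := gdist_adj xy.
  rewrite (gdist_sym _ x); lia.
have psi_b y : (#|[set x | psi x == y]| <= b)%N.
  apply: leq_trans (card_ball a (phi y) degH).
  apply/subset_leq_card/subsetP => x; rewrite !inE => /eqP <-.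
  by rewrite gdist_sym.
have [F [sF le_F FK]] := coarse_edge_cut degG degH psi_r psi_b sE EK.
exists F; split=> // [|F' sFF' C /(FK _ sFF')/leq_trans-> //].
  by apply: leq_trans le_F _; rewrite leq_mul2r leq_addl orbT.
by rewrite leq_mul2r -addnA addnCA leq_addr orbT.
Qed.

(** * Convergence of edge densities and conclusion *)

Local Open Scope classical_set_scope.

(** Truncation changes [c * v n] by less than 1, hence the ratio by less than [1 / v n], which tends
    to 0. *)
Lemma cvg_truncn_ratio (R : realType) (c : R) (u v : nat -> nat) :
  0 <= c -> v @ \oo --> \oo ->
  (\forall n \near \oo, u n = Num.truncn (c * (v n)%:R)) ->
  (fun n => (u n)%:R / (v n)%:R : R) @ \oo --> c.
Proof.
move=> c_ge0 v_oo u_eq; apply/cvgrPdist_lt => e e_gt0.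
have v_ge : \forall n \near \oo, ((Num.truncn e^-1).+1 <= v n)%N.
  exact: v_oo (nbhs_infty_ge _).
near=> n.
have -> : u n = Num.truncn (c * (v n)%:R) by near: n.
have le_v : ((Num.truncn e^-1).+1 <= v n)%N by near: n.
have v_gt0 : 0 < (v n)%:R :> R by rewrite ltr0n (leq_trans _ le_v).
have ev : e^-1 < (v n)%:R.
  by apply: lt_le_trans (truncnS_gt _) _; rewrite ler_nat.
have ev1 : 1 < e * (v n)%:R by rewrite -ltr_pdivrMl // mulr1.
have /andP[t_le t_gt] := truncn_itv (mulr_ge0 c_ge0 (ltW v_gt0)).
rewrite -natr1 in t_gt.
rewrite ger0_norm ?subr_ge0 ?ler_pdivrMr // ltrBlDr -ltrBlDl ltr_pdivlMr //.
by rewrite mulrBl; lra.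
Unshelve. all: by end_near. Qed.

Theorem theorem0p3 (R : realType) (G H : nat -> graph)
    (hG : graph_sequence G) (hH : graph_sequence H)
    (hGH : coarsely_equivalent R G H) :
  hyperfinite R G -> hyperfinite R H.
Proof.
case: hG hH hGH => [[d1 deg1] _] [[d2 deg2] H_oo] [A A_gt0 qi] hypG eps eps_gt0.
pose d := maxn d1 d2.
have degG n (x : G n) : (degree x <= d)%N by rewrite leq_max deg1.
have degH n (x : H n) : (degree x <= d)%N by rewrite leq_max deg2 orbT.
have [M cutM] := quasi_isometry_edge_cut d A_gt0.
(* [c] will be the limit density: below [eps], and at most 1/2 so that enough edges exist to reach
   it. *)
pose c : R := Num.min eps 1 / 2.
have [c_gt0 c_eps c_half] : [/\ 0 < c, c < eps & c <= 1 / 2].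
  by rewrite /c; case: (lerP eps 1) => ?; split; lra.
(* One factor [M] compares [F] with [E], the other [G n] with [H n]; adding 1 keeps the divisor
   positive. *)
pose M1 : R := M%:R * M%:R + 1.
have M1_gt0 : 0 < M1 by rewrite ltr_wpDl // mulr_ge0.
have [K [E [K_gt0 sE [l E_l l_lt] EK]]] := hypG (c / M1) (divr_gt0 c_gt0 M1_gt0).
have small_E : \forall n \near \oo, #|E n|%:R / #|G n|%:R < c / M1.
  by apply: (cvgr_lt l).
have H_gt1 : \forall n \near \oo, (1 < #|H n|)%N by exact: H_oo (nbhs_infty_ge 2).
(* The exact size is demanded only under conditions that hold for all large [n], which suffices for
   the limit. *)
pose good n (F : {set {set H n}}) :=
  [/\ F \subset edges (H n),
      forall C, C \in components (del_edges F) -> (#|C| <= M * K)%N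
    & #|E n|%:R / #|G n|%:R < c / M1 -> (1 < #|H n|)%N ->
      #|F| = Num.truncn (c * #|H n|%:R)].
have goodP n : exists F, good n F.
  have [phi qi_phi] := qi n.
  have [le_GH cutE] := cutM _ _ phi (@degG n) (@degH n) qi_phi.
  have [F [sF le_F FK]] := cutE _ _ (sE n) (EK n).
  case: (boolP ((#|E n|%:R / #|G n|%:R < c / M1) && (1 < #|H n|)%N)); last first.
    move=> not_large; exists F; split=> //; first exact: FK.
    by move=> lt_E gt_H; rewrite lt_E gt_H in not_large.
  case/andP=> lt_E gt_H.
  have cH_ge0 : 0 <= c * #|H n|%:R by rewrite mulr_ge0 // ltW.
  have [|F' [sFF' sF' F'_card]] :=
    exists_subset_card (m := Num.truncn (c * #|H n|%:R)) sF.
    apply/andP; split.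
      rewrite truncn_ge_nat //.
      (* Chain: [M * #|E n|] is at most [M * (c / M1) * #|G n|], hence at most
         [M * M / M1 * c * #|H n|], and [M * M < M1]. *)
      move: lt_E; rewrite ltr_pdivrMr ?ltr0n ?vertex_gt0 // => lt_E.
      apply: (@le_trans _ _ (M%:R * #|E n|%:R)); first by rewrite -natrM ler_nat.
      apply: (@le_trans _ _ (M%:R * (c / M1 * (M%:R * #|H n|%:R)))).
        rewrite ler_wpM2l //; apply: le_trans (ltW lt_E) _.
        apply: ler_wpM2l; first exact/ltW/divr_gt0.
        by rewrite -natrM ler_nat.
      have -> : M%:R * (c / M1 * (M%:R * #|H n|%:R)) =
                (M1 - 1) / M1 * (c * #|H n|%:R) by rewrite /M1; ring.
      by rewrite ler_piMl // ler_pdivrMr //; lra.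
    (* The target is at most half the number of vertices, hence at most the number of edges. *)
    rewrite -(ler_nat R); apply: (@le_trans _ _ (c * #|H n|%:R)).
      by rewrite truncn_le.
    have := card_vertex_le_edges gt_H; rewrite -(ler_nat R) natrM => le_H.
    have : c * #|H n|%:R <= 1 / 2 * #|H n|%:R by rewrite ler_wpM2r.
    lra.
  by exists F'; split=> //; apply: FK.
pose F n := sval (cid (goodP n)).
have goodF n : good n (F n) := svalP (cid (goodP n)).
(* The successor makes the bound positive whatever the value of [M]. *)
exists (M * K).+1, F; split=> //.
- by move=> n; case: (goodF n).
- exists c => //; apply: cvg_truncn_ratio => //; first exact: ltW.
  near=> n; have [_ _ ->//] := goodF n; by near: n.
- by move=> n C CF; have [_ /(_ C CF)/leqW] := goodF n.
Unshelve. all: by end_near. Qed.
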